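(* For any nonnegative $f \in L^1([0,1))$, any Carleson sequence $\{\alpha_J\}_{J \in \mathcal{D}([0,1))}$ with constant at most $1$, and any $\lambda>0$, we have $$\bigl| \bigl\{ x\in [0,1):\ \mathcal{A}f(x) > \lambda \bigr\} \bigr| \leq \begin{cases} \dfrac{2\|f\|_{L^1}}{\lambda + \|f\|_{L^1}} & \text{if } \|f\|_{L^1} \leq \lambda, \\[6pt] 1 & \text{if } \|f\|_{L^1} \geq \lambda,\end{cases}$$ and this bound is sharp, i.e. for every $\lambda>0$ and every $s\ge 0$ the right-hand side with $\|f\|_{L^1}=s$ is the supremum of the left-hand side over all nonnegative $f\in L^1([0,1))$ with $\|f\|_{L^1}=s$ and all such Carleson sequences. In particular $$\|\mathcal{A}f\|_{L^{1,\infty}([0,1))} \leq 2\|f\|_{L^1([0,1))}$$ for all such $f$ and all such Carleson sequences, and the constant $2$ is sharp (it cannot be replaced by any smaller constant).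
   Context: $\mathcal{D}([0,1))$ is the collection of dyadic subintervals of $[0,1)$ (including $[0,1)$ itself), i.e. the half-open intervals obtained by repeated bisection; $\mathcal{D}(J)$ is defined in the same way for any dyadic interval $J$. $|E|$ is Lebesgue measure, $\langle f\rangle_J=\frac{1}{|J|}\int_J f$, and $\mathbf{1}_J$ is the indicator function of $J$. A Carleson sequence with constant at most $1$ is a family $\{\alpha_J\}_{J\in\mathcal{D}([0,1))}$ with $\alpha_J\ge 0$ and $\sup_{J\in\mathcal{D}([0,1))}\frac{1}{|J|}\sum_{K\in\mathcal{D}(J)}\alpha_K|K|\le 1$. Given such a sequence, $\mathcal{A}f=\sum_{J\in\mathcal{D}([0,1))}\alpha_J\langle f\rangle_J\mathbf{1}_J$. The weak norm is $\|g\|_{L^{1,\infty}([0,1))}=\sup_{\lambda>0}\lambda\,|\{x\in[0,1):|g(x)|>\lambda\}|$. *)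

(* Defs.v *)
From HB Require Import structures.
From mathcomp Require Import all_boot all_order all_algebra.
From mathcomp Require Import all_classical all_reals all_analysis.

Set Implicit Arguments.
Unset Strict Implicit.
Unset Printing Implicit Defensive.

Import Order.TTheory GRing.Theory Num.Theory.
Import numFieldNormedType.Exports.

Local Open Scope classical_set_scope.
Local Open Scope ring_scope.

Definition unit_itv (R : realType) : set R := `[0, 1[.

(* [dyadic J K]: K is obtained from J by repeated bisection.  For a nonempty
   half-open J no degenerate (empty) interval is ever produced. *)
Inductive dyadic (R : realType) (J : set R) : set R -> Prop :=
| dyadic_self : dyadic J J
| dyadic_left (a b : R) : dyadic J `[a, b[ -> dyadic J `[a, (a + b) / 2[
| dyadic_right (a b : R) : dyadic J `[a, b[ -> dyadic J `[(a + b) / 2, b[.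

Definition meas (R : realType) (E : set R) : \bar R := lebesgue_measure E.

Definition avg (R : realType) (f : R -> R) (J : set R) : R :=
  (fine (meas J))^-1 * \int[lebesgue_measure]_(x in J) f x.

(* Only the values of [alpha] on dyadic subintervals of [0, 1) matter. *)
Definition carleson_seq (R : realType) (alpha : set R -> R) : Prop :=
  (forall J, dyadic (@unit_itv R) J -> 0 <= alpha J) /\
  (ereal_sup [set (fine (meas J))^-1%:E *
                  \esum_(K in dyadic J) ((alpha K)%:E * meas K)
             | J in dyadic (@unit_itv R)] <= 1)%E.

(* Extended-real valued: the sum of nonnegative terms may diverge at some x. *)
Definition carleson_op (R : realType) (alpha : set R -> R) (f : R -> R)
    (x : R) : \bar R :=
  \esum_(J in dyadic (@unit_itv R)) (alpha J * avg f J * \1_J x)%:E.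

(* Only the values of [f] on [0, 1) matter. *)
Definition nonneg_L1 (R : realType) (f : R -> R) : Prop :=
  lebesgue_measure.-integrable (@unit_itv R) (EFin \o f) /\
  (forall x, unit_itv x -> 0 <= f x).

Definition norm_L1 (R : realType) (f : R -> R) : R :=
  \int[lebesgue_measure]_(x in @unit_itv R) `|f x|.

Definition superlevel (R : realType) (g : R -> \bar R) (lambda : R) : set R :=
  [set x | unit_itv x /\ (lambda%:E < g x)%E].

Definition weak_norm (R : realType) (g : R -> \bar R) : \bar R :=
  ereal_sup [set (lambda%:E * meas (superlevel (fun x => `|g x|) lambda))%E
            | lambda in [set lambda : R | 0 < lambda]].

(* Both branches equal 1 when s = lambda > 0. *)
Definition weak_bound (R : realType) (lambda s : R) : R :=
  if s <= lambda then 2 * s / (lambda + s) else 1.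

(* Main.v *)
Require Import Defs.
From HB Require Import structures.
From mathcomp Require Import all_boot all_order all_algebra.
From mathcomp Require Import all_classical all_reals all_analysis.
From mathcomp Require Import measurable_realfun ring lra.

Set Implicit Arguments.
Unset Strict Implicit.
Unset Printing Implicit Defensive.

Import Order.TTheory GRing.Theory Num.Theory.
Import numFieldNormedType.Exports.

Local Open Scope classical_set_scope.
Local Open Scope ring_scope.

(** Write s for the average of f over a dyadic interval J, A for the sum of the
    alpha_K |K| over the dyadic K inside J, divided by |J|, and lambda for the
    level still to be exceeded on J.  Entering J costs al = alpha_J: the state
    (s, A, lambda) jumps to (s, A - al, lambda - al s), and the new s and A are
    the means of their values on the two halves of J.  The density of the
    superlevel set is therefore controlled by any nonnegative function of the
    state that is midpoint concave in (s, A), does not increase along a jump,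
    and is at least 1 as soon as A s reaches lambda.

    Upper bound.  The extremal choice is HM(s, lambda A) / lambda when
    s <= lambda A and GM(s, lambda A) / lambda when s >= lambda A, truncated
    at 1, with HM and GM the harmonic and geometric means.  Its supporting
    planes in (s, A) can be chosen so that one family, indexed by lambda alone,
    is preserved by the jumps: for each kappa > 0, as long as
    kappa lambda <= 1, the function
      mass_weight (kappa lambda) kappa s + carleson_weight (kappa lambda) A
    does not increase along a jump made while A s <= lambda ([potential_jump])
    and is at least 1 where A s >= lambda ([potential_ge1]).  Being linear in
    (s, A), it passes to the halves with equality, so that an induction on the
    number of generations bounds the superlevel set by it
    ([truncated_weak_bound]).  The plane that touches the extremal function at
    A = 1 is kappa = 1 / (lambda + s), and its value there is
    2 s / (lambda + s) ([weak_type_bound]).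

    Sharpness.  Given data on the two halves of an interval, one may glue them
    and put any coefficient on top as long as the Carleson constant stays at
    most 1 ([achievable_glue]).  Spending a small coefficient d = 1 - r on an
    interval where A = 1 leaves room only on a fraction r of it; put all of f
    there, which restores A = 1 and divides the average by r.  After n rounds
    the survivors have density q = r^n and average s / q, and the level has
    been lowered by r (1 - q) s / q, hence by nearly s / q - s.  A last
    coefficient 1 finishes if what remains of lambda is below s / q, which in
    the limit r -> 1 reads q < 2 s / (lambda + s) ([achievable_near_bound]).

    The weak norm inequality follows from lambda times the bound being at most
    2 s; its constant is approached for fixed s as lambda grows. *)

(** * The potential *)

(** For t >= 1/2 these are the slopes of the plane tangent to HM(s, t A) / t
    along s = (1 - t) A; for t <= 1/2, of the plane tangent to GM(s, t A) / t
    along A = 4 t s.  The two regimes agree at t = 1/2. *)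
Definition mass_weight (R : realFieldType) (t : R) : R :=
  if 2^-1 <= t then 2 * t else 1.

Definition carleson_weight (R : realFieldType) (t : R) : R :=
  if 2^-1 <= t then 2 * (1 - t) ^+ 2 else (4 * t)^-1.

Lemma mass_weight_ge1 (R : realFieldType) (t : R) : 1 <= mass_weight t.
Proof. by rewrite /mass_weight; case: ifPn => // ht; lra. Qed.

(** Along A s = t the potential is smallest at A = 1 in the harmonic regime,
    with value 1 + (2t - 1)^2; in the geometric regime it is bounded below by
    the inequality between arithmetic and geometric means. *)
Lemma potential_ge1 (R : realFieldType) (t s A : R) :
  0 < t <= 1 -> 0 <= A <= 1 -> t <= A * s ->
  1 <= mass_weight t * s + carleson_weight t * A.
Proof.
move=> /andP[t0 t1] /andP[A0 A1] tAs; rewrite /mass_weight /carleson_weight.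
have Apos : 0 < A by rewrite lt_def A0 andbT; apply: contraTneq tAs => ->; lra.
have tAleS : t / A <= s by rewrite ler_pdivrMr// mulrC.
case: ifPn => [ht|].
  have weight : 2 * t * (t / A) <= 2 * t * s by apply: ler_wpM2l => //; lra.
  suff : 1 <= 2 * t * (t / A) + 2 * (1 - t) ^+ 2 * A by lra.
  have -> : 2 * t * (t / A) + 2 * (1 - t) ^+ 2 * A = 1 +
      ((2 * t - 1) ^+ 2 + (1 - A) * (1 - 2 * (1 - t) ^+ 2 * (1 + A))) / A.
    by field; lra.
  rewrite lerDl divr_ge0// addr_ge0 ?sqr_ge0// mulr_ge0 ?subr_ge0//.
  have r4 : (1 - t) ^+ 2 <= 4^-1 by nra.
  nra.
rewrite -ltNge => ht.
suff : 1 <= t / A + (4 * t)^-1 * A by lra.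
have -> : t / A + (4 * t)^-1 * A = 1 + ((2 * t - A) ^+ 2) / (4 * t * A).
  by field; apply/andP; split; lra.
by rewrite lerDl divr_ge0 ?sqr_ge0//; nra.
Qed.

(** In the geometric regime only the coefficient of A moves, and
    (A - al) / (t - al s) <= A / t comes down to al (A s) <= al t. *)
Lemma potential_jump_lo (R : realFieldType) (t s A al : R) :
  0 <= s -> 0 <= al -> A * s <= t -> 0 < t - al * s -> t <= 2^-1 ->
  mass_weight (t - al * s) * s + carleson_weight (t - al * s) * (A - al)
  <= mass_weight t * s + carleson_weight t * A.
Proof.
move=> s0 al0 Ast t'0 t_le.
have als0 : 0 <= al * s by apply: mulr_ge0.
have mass1 u : u <= 2^-1 -> mass_weight u = 1 :> R.
  move=> hu; rewrite /mass_weight; case: ifPn => // hu'.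
  have -> : u = 2^-1 by apply/eqP; rewrite eq_le hu.
  by field.
have carl u : 0 < u -> u <= 2^-1 -> carleson_weight u = (4 * u)^-1 :> R.
  move=> u0 hu; rewrite /carleson_weight; case: ifPn => // hu'.
  have -> : u = 2^-1 by apply/eqP; rewrite eq_le hu.
  by field.
rewrite !mass1; [|lra..].
rewrite !carl; [|lra..].
rewrite lerD2l -subr_ge0.
have -> : (4 * t)^-1 * A - (4 * (t - al * s))^-1 * (A - al) =
    (al * (t - A * s)) / (4 * t * (t - al * s)).
  by field; apply/andP; split; lra.
rewrite divr_ge0// mulr_ge0//; lra.
Qed.

(** In the harmonic regime the loss is 2 al times the sum of a square and of
    s^2 (1 - (A - al) A), which is nonnegative because A <= 1. *)
Lemma potential_jump_hi (R : realFieldType) (t s A al : R) :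
  0 <= s -> 0 <= al <= A -> A <= 1 -> 2^-1 <= t - al * s -> t <= 1 ->
  mass_weight (t - al * s) * s + carleson_weight (t - al * s) * (A - al)
  <= mass_weight t * s + carleson_weight t * A.
Proof.
move=> s0 /andP[al0 alA] A1 t'_ge t1.
have als0 : 0 <= al * s by apply: mulr_ge0.
have t_ge : 2^-1 <= t by lra.
rewrite /mass_weight /carleson_weight t'_ge t_ge -subr_ge0.
have -> : 2 * t * s + 2 * (1 - t) ^+ 2 * A
    - (2 * (t - al * s) * s + 2 * (1 - (t - al * s)) ^+ 2 * (A - al)) =
    2 * al * ((1 - t - s * (A - al)) ^+ 2 + s ^+ 2 * (1 - (A - al) * A)).
  by ring.
have dA : (A - al) * A <= 1 by nra.
apply: mulr_ge0; first exact: mulr_ge0.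
by rewrite addr_ge0 ?sqr_ge0// mulr_ge0 ?sqr_ge0// subr_ge0.
Qed.

(** A jump that crosses t = 1/2 is the composition of two jumps: stop at 1/2,
    where the two regimes agree. *)
Lemma potential_jump (R : realFieldType) (t s A al : R) :
  0 <= s -> 0 <= al <= A -> A <= 1 -> A * s <= t -> 0 < t - al * s -> t <= 1 ->
  mass_weight (t - al * s) * s + carleson_weight (t - al * s) * (A - al)
  <= mass_weight t * s + carleson_weight t * A.
Proof.
move=> s0 /andP[al0 alA] A1 Ast t'0 t1.
have als0 : 0 <= al * s by apply: mulr_ge0.
have [t_le|t_gt] := leP t 2^-1; first exact: potential_jump_lo.
have [t'_ge|t'_lt] := leP 2^-1 (t - al * s).
  by apply: potential_jump_hi => //; apply/andP.
have spos : 0 < s.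
  rewrite lt_def s0 andbT; apply: contraTneq t'_lt => ->.
  by rewrite -leNgt; lra.
pose al1 := (t - 2^-1) / s.
have al1s : al1 * s = t - 2^-1 by rewrite /al1 mulfVK//; lra.
have al1_ge0 : 0 <= al1 by rewrite divr_ge0//; lra.
have al1_le : al1 <= al by rewrite ler_pdivrMr//; lra.
have stop : t - al1 * s = 2^-1 by lra.
have split : t - al * s = 2^-1 - (al - al1) * s by rewrite mulrBl; lra.
rewrite split.
have -> : A - al = A - al1 - (al - al1) by ring.
have al1A : 0 <= al1 <= A by rewrite al1_ge0 (le_trans al1_le).
have t1_ge : 2^-1 <= t - al1 * s by rewrite stop.
apply: le_trans (potential_jump_hi s0 al1A A1 t1_ge t1).
rewrite stop; apply: potential_jump_lo => //; first lra.
  by rewrite mulrBl; lra.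
by rewrite -split.
Qed.

(** * Dyadic intervals and sums over them *)

Lemma esumU (R : realType) (T : choiceType) (X Y : set T) (g : T -> \bar R) :
  (forall t, X t -> ~ Y t) -> (forall t, (X `|` Y) t -> (0 <= g t)%E) ->
  (\esum_(t in X `|` Y) g t = \esum_(t in X) g t + \esum_(t in Y) g t)%E.
Proof.
move=> XY g0; rewrite (esumID X)//.
congr (\esum_(t in _) g t + \esum_(t in _) g t)%E; apply/seteqP; split => t /=.
- by case.
- by move=> Xt; split => //; left.
- by case=> -[].
- by move=> Yt; split=> [|/XY//]; right.
Qed.

Lemma esum_subset (R : realType) (T : choiceType) (X Y : set T)
    (g : T -> \bar R) :
  X `<=` Y -> (\esum_(t in X) g t <= \esum_(t in Y) g t)%E.
Proof.
move=> XY; apply: ge_ereal_sup => _ [F [finF FX] <-]; apply: esum_ge.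
by exists F => //; split=> //; exact: subset_trans XY.
Qed.

(** Dyadic families are sets of sets, so endpoints have to be recovered from
    the interval they bound. *)
Lemma itv_co_inj (R : realType) (a b c d : R) :
  a < b -> `[a, b[%classic = `[c, d[%classic -> a = c /\ b = d.
Proof.
move=> ab E.
have sub (u v u' v' : R) : u < v -> `[u, v[%classic `<=` `[u', v'[%classic ->
    u' <= u /\ v <= v'.
  move=> uv S; have := S u.
  rewrite /= !in_itv/= lexx uv => /(_ isT)/andP[u'u uv'].
  split=> //; rewrite leNgt; apply/negP => v'v.
  by have := S v'; rewrite /= !in_itv/= ltxx andbF v'v (ltW uv') => /(_ isT).
have cd : c < d.
  by have : `[a, b[%classic a; [rewrite /= in_itv/= lexx|rewrite E/= in_itv/=];
    lra.
have [|ca bd] := sub a b c d ab; first by rewrite E.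
have [|ac db] := sub c d a b cd; first by rewrite E.
by split; apply/le_anti/andP.
Qed.

Lemma meas_co (R : realType) (a b : R) :
  a < b -> meas `[a, b[%classic = (b - a)%:E.
Proof. by move=> ab; rewrite /meas lebesgue_measure_itv/= lte_fin ab. Qed.

Lemma dyadic_itv (R : realType) (a b : R) (K : set R) : a < b ->
  dyadic `[a, b[%classic K ->
  exists c d : R, [/\ a <= c, c < d, d <= b & K = `[c, d[%classic].
Proof.
move=> ab; elim=> [|c d _|c d _].
- by exists a, b.
- case=> c' [d' [ac' cd' db E]]; exists c, ((c + d) / 2).
  have [cc' dd'] := itv_co_inj cd' (esym E); subst c' d'.
  by split=> //; lra.
- case=> c' [d' [ac' cd' db E]]; exists ((c + d) / 2), d.
  have [cc' dd'] := itv_co_inj cd' (esym E); subst c' d'.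
  by split=> //; lra.
Qed.

Lemma dyadic_sub (R : realType) (a b : R) (K : set R) : a < b ->
  dyadic `[a, b[%classic K -> K `<=` `[a, b[%classic.
Proof.
move=> ab /(dyadic_itv ab)[c [d [ac cd db ->]]] x /=; rewrite !in_itv/=; lra.
Qed.

Lemma dyadic_trans (R : realType) (I J K : set R) :
  dyadic I J -> dyadic J K -> dyadic I K.
Proof.
move=> IJ; elim=> // a b _ IJ'.
- exact: dyadic_left.
- exact: dyadic_right.
Qed.

Lemma dyadic_split (R : realType) (a b : R) : a < b ->
  dyadic `[a, b[%classic =
  [set `[a, b[%classic] `|` (dyadic `[a, (a + b) / 2[%classic `|`
                             dyadic `[(a + b) / 2, b[%classic).
Proof.
move=> ab; apply/seteqP; split=> K /=.
- elim=> [|c d _ IH|c d _ IH]; first by left.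
  + case: IH => [E|[IH|IH]].
    * have [-> ->] := itv_co_inj ab (esym E).
      by right; left; exact: dyadic_self.
    * by right; left; exact: dyadic_left.
    * by right; right; exact: dyadic_left.
  + case: IH => [E|[IH|IH]].
    * have [-> ->] := itv_co_inj ab (esym E).
      by right; right; exact: dyadic_self.
    * by right; left; exact: dyadic_right.
    * by right; right; exact: dyadic_right.
- case=> [->|[|]]; first exact: dyadic_self.
  + by apply: dyadic_trans; apply: dyadic_left; exact: dyadic_self.
  + by apply: dyadic_trans; apply: dyadic_right; exact: dyadic_self.
Qed.

Lemma dyadic_halves_disjoint (R : realType) (a b : R) (K : set R) : a < b ->
  dyadic `[a, (a + b) / 2[%classic K -> ~ dyadic `[(a + b) / 2, b[%classic K.
Proof.
move=> ab Kl Kr; have [|c [d [ac cd dm KE]]] := dyadic_itv _ Kl; first lra.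
have : K c by rewrite KE/= in_itv/= lexx.
move=> /(dyadic_sub _ Kr); rewrite /= in_itv/=; lra.
Qed.

Lemma dyadic_left_neq (R : realType) (a b : R) (K : set R) : a < b ->
  dyadic `[a, (a + b) / 2[%classic K -> K <> `[a, b[%classic.
Proof.
move=> ab /(dyadic_sub _) KJ E.
have := KJ ltac:(lra) ((a + b) / 2); rewrite E /= !in_itv/=; lra.
Qed.

Lemma dyadic_right_neq (R : realType) (a b : R) (K : set R) : a < b ->
  dyadic `[(a + b) / 2, b[%classic K -> K <> `[a, b[%classic.
Proof.
move=> ab /(dyadic_sub _) KJ E.
have := KJ ltac:(lra) a; rewrite E /= !in_itv/=; lra.
Qed.

(** Stated for arbitrary families X and Y below the two halves, so as to apply
    both to all dyadic intervals and to finitely many generations. *)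
Lemma esum_halves (R : realType) (a b : R) (X Y : set (set R))
    (g : set R -> \bar R) : a < b ->
  X `<=` dyadic `[a, (a + b) / 2[%classic ->
  Y `<=` dyadic `[(a + b) / 2, b[%classic ->
  (forall K, ([set `[a, b[%classic] `|` (X `|` Y)) K -> (0 <= g K)%E) ->
  (\esum_(K in [set `[a, b[%classic] `|` (X `|` Y)) g K =
   g `[a, b[%classic + (\esum_(K in X) g K + \esum_(K in Y) g K))%E.
Proof.
move=> ab Xl Yr g0; rewrite esumU//; last first.
  move=> K /= -> [/Xl|/Yr] JJ.
  - exact: (dyadic_left_neq ab JJ).
  - exact: (dyadic_right_neq ab JJ).
rewrite esum_set1; last by apply: g0; left.
rewrite esumU// => K; first by move=> /Xl Kl /Yr; exact: dyadic_halves_disjoint.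
by move=> XYK; apply: g0; right.
Qed.

Lemma esum_dyadic (R : realType) (a b : R) (g : set R -> \bar R) : a < b ->
  (forall K, dyadic `[a, b[%classic K -> (0 <= g K)%E) ->
  (\esum_(K in dyadic `[a, b[%classic) g K =
   g `[a, b[%classic + (\esum_(K in dyadic `[a, ((a + b) / 2)%R[%classic) g K +
                        \esum_(K in dyadic `[((a + b) / 2)%R, b[%classic) g K))%E.
Proof.
by move=> ab; rewrite dyadic_split// => g0; rewrite esum_halves.
Qed.

(** The dyadic subintervals of the first n generations, the recursion going
    down from the root so that the halving identities apply to each step. *)
Fixpoint dyadic_upto (R : realType) (n : nat) (a b : R) : set (set R) :=
  if n is k.+1 then
    [set `[a, b[%classic] `|`
    (dyadic_upto k a ((a + b) / 2) `|` dyadic_upto k ((a + b) / 2) b)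
  else set0.

Lemma dyadic_upto_sub (R : realType) n (a b : R) : a < b ->
  dyadic_upto n a b `<=` dyadic `[a, b[%classic.
Proof.
elim: n a b => [//|n IH] a b ab; rewrite dyadic_split//=.
by apply: setUS; apply: setUSS; apply: IH; lra.
Qed.

Lemma dyadic_upto_nd (R : realType) n k (a b : R) :
  (n <= k)%N -> dyadic_upto n a b `<=` dyadic_upto k a b.
Proof.
elim: n k a b => [|n IH] [|k] a b nk //=.
by apply: setUS; apply: setUSS; apply: IH.
Qed.

Lemma dyadic_uptoS (R : realType) n (a b c d : R) : a < b ->
  dyadic_upto n a b `[c, d[%classic ->
  dyadic_upto n.+1 a b `[c, (c + d) / 2[%classic /\
  dyadic_upto n.+1 a b `[(c + d) / 2, d[%classic.
Proof.
elim: n a b => // n IH a b ab /= [E|].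
  have [<- <-] := itv_co_inj ab (esym E).
  by split; right; [left|right]; left.
case=> /IH [|hl hr].
- by lra.
- by split; right; left.
- by lra.
- by split; right; right.
Qed.

Lemma dyadic_bigcup (R : realType) (a b : R) (K : set R) : a < b ->
  dyadic `[a, b[%classic K -> exists n, dyadic_upto n a b K.
Proof.
move=> ab; elim=> [|c d _ [n] /(dyadic_uptoS ab)[? ?]|
                    c d _ [n] /(dyadic_uptoS ab)[? ?]].
- by exists 1; left.
- by exists n.+1.
- by exists n.+1.
Qed.

(** Such a sum is a supremum over finite families, and each finite family lies
    in finitely many generations. *)
Lemma esum_dyadic_gt (R : realType) (a b : R) (g : set R -> \bar R)
    (y : \bar R) : a < b ->
  (forall K, dyadic `[a, b[%classic K -> (0 <= g K)%E) ->
  (y < \esum_(K in dyadic `[a, b[%classic) g K)%E <->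
  exists n, (y < \esum_(K in dyadic_upto n a b) g K)%E.
Proof.
move=> ab g0; split; last first.
  case=> n yn; apply: (lt_le_trans yn).
  by apply: esum_subset; exact: dyadic_upto_sub.
move=> /ereal_sup_gt[_ [F [finF FJ] <-] yF].
suff [n Fn] : exists n, F `<=` dyadic_upto n a b.
  by exists n; apply: (lt_le_trans yF); apply: esum_ge; exists F.
have [s Es] := (finite_seqP F).1 finF.
rewrite Es in FJ *; elim: s {Es finF yF F} FJ => [|K s IH] FJ.
  by exists 0.
have [|n sn] := IH; first by move=> L sL; apply: FJ => /=; rewrite inE sL orbT.
have [k Kk] := dyadic_bigcup ab (FJ K (mem_head _ _)).
exists (maxn n k) => L /=; rewrite inE => /orP[/eqP ->|sL].
- by apply: dyadic_upto_nd Kk; exact: leq_maxr.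
- by apply: dyadic_upto_nd (sn L sL); exact: leq_maxl.
Qed.

(** * Carleson sequences and the operator on a dyadic interval *)

(** Relative to an interval J, as is [carleson_on] below, so as to be inherited
    by the halves of J. *)
Definition nonneg_L1_on (R : realType) (J : set R) (f : R -> R) : Prop :=
  lebesgue_measure.-integrable J (EFin \o f) /\ (forall x, J x -> 0 <= f x).

Definition carleson_mass (R : realType) (alpha : set R -> R)
    (X : set (set R)) : \bar R :=
  \esum_(K in X) ((alpha K)%:E * meas K)%E.

Definition carleson_on (R : realType) (J : set R) (alpha : set R -> R) : Prop :=
  (forall K, dyadic J K -> 0 <= alpha K) /\
  (forall K, dyadic J K -> (carleson_mass alpha (dyadic K) <= meas K)%E).

Definition partial_op (R : realType) (alpha : set R -> R) (f : R -> R)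
    (X : set (set R)) (x : R) : \bar R :=
  \esum_(K in X) (alpha K * avg f K * \1_K x)%:E.

Lemma carleson_seqE (R : realType) (alpha : set R -> R) :
  carleson_seq alpha <-> carleson_on (@unit_itv R) alpha.
Proof.
have eqv K : dyadic (@unit_itv R) K ->
   ((fine (meas K))^-1%:E * carleson_mass alpha (dyadic K) <= 1)%E =
   (carleson_mass alpha (dyadic K) <= meas K)%E.
  move=> /(dyadic_itv (@ltr01 R))[c [d [_ cd _ ->]]]; rewrite meas_co//=.
  by rewrite lee_pdivrMl ?mule1// subr_gt0.
split=> -[a0 H]; split=> //.
- move=> K JK; rewrite -eqv//; apply: le_trans H.
  by apply: ereal_sup_ubound; exists K.
- by apply: ge_ereal_sup => _ [K JK <-]; rewrite eqv//; exact: H.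
Qed.

Lemma dyadic_left_half (R : realType) (a b : R) :
  dyadic `[a, b[%classic `[a, (a + b) / 2[%classic.
Proof. by apply: dyadic_left; exact: dyadic_self. Qed.

Lemma dyadic_right_half (R : realType) (a b : R) :
  dyadic `[a, b[%classic `[(a + b) / 2, b[%classic.
Proof. by apply: dyadic_right; exact: dyadic_self. Qed.

Lemma carleson_on_sub (R : realType) (alpha : set R -> R) (J K : set R) :
  dyadic J K -> carleson_on J alpha -> carleson_on K alpha.
Proof.
move=> JK [a0 H]; split=> L KL; first by apply: a0; exact: dyadic_trans KL.
by apply: H; exact: dyadic_trans KL.
Qed.

Lemma nonneg_L1_on_sub (R : realType) (f : R -> R) (a b : R) (K : set R) :
  a < b -> dyadic `[a, b[%classic K ->
  nonneg_L1_on `[a, b[%classic f -> nonneg_L1_on K f.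
Proof.
move=> ab JK [intf f0]; have KJ := dyadic_sub ab JK.
have [c [d [_ _ _ KE]]] := dyadic_itv ab JK.
split; last by move=> x /KJ/f0.
by apply: integrableS intf => //; rewrite KE.
Qed.

Lemma avg_ge0 (R : realType) (f : R -> R) (K : set R) :
  (forall x, K x -> 0 <= f x) -> 0 <= avg f K.
Proof.
move=> f0; apply: mulr_ge0; last exact: Rintegral_ge0.
by rewrite invr_ge0 fine_ge0// /meas measure_ge0.
Qed.

Lemma avg_co (R : realType) (f : R -> R) (a b : R) : a < b ->
  \int[lebesgue_measure]_(x in `[a, b[) f x = avg f `[a, b[%classic * (b - a).
Proof.
by move=> ab; rewrite /avg meas_co//= mulrC mulVKf// subr_eq0 gt_eqF.
Qed.

Lemma co_halves (R : realType) (a b : R) : a < b ->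
  `[a, b[%classic =
  `[a, (a + b) / 2[%classic `|` `[(a + b) / 2, b[%classic.
Proof.
move=> ab; apply/seteqP; split=> x /=; rewrite !in_itv/=.
  by move=> /andP[ax xb]; have [xm|mx] := ltP x ((a + b) / 2);
    [left; rewrite ax|right].
by case; lra.
Qed.

Lemma Rintegral_halves (R : realType) (f : R -> R) (a b : R) : a < b ->
  lebesgue_measure.-integrable `[a, b[ (EFin \o f) ->
  \int[lebesgue_measure]_(x in `[a, b[) f x =
  \int[lebesgue_measure]_(x in `[a, (a + b) / 2[) f x +
  \int[lebesgue_measure]_(x in `[(a + b) / 2, b[) f x.
Proof.
move=> ab; rewrite co_halves// => intf; rewrite Rintegral_setU//.
apply/disj_setPS => x [] /=; rewrite !in_itv/=; lra.
Qed.

Lemma partial_op_term_ge0 (R : realType) (alpha : set R -> R) (f : R -> R)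
    (a b x : R) (K : set R) : a < b -> nonneg_L1_on `[a, b[%classic f ->
  carleson_on `[a, b[%classic alpha -> dyadic `[a, b[%classic K ->
  (0 <= (alpha K * avg f K * \1_K x)%:E)%E.
Proof.
move=> ab f0 [a0 _] JK; rewrite lee_fin mulr_ge0// mulr_ge0 ?a0//.
by apply: avg_ge0; case: (nonneg_L1_on_sub ab JK f0).
Qed.

Lemma partial_op_out (R : realType) (alpha : set R -> R) (f : R -> R)
    (a b x : R) (X : set (set R)) : a < b -> X `<=` dyadic `[a, b[%classic ->
  ~ `[a, b[%classic x -> partial_op alpha f X x = 0%E.
Proof.
move=> ab XJ Jx; apply: esum1 => K /XJ /(dyadic_sub ab) KJ.
by rewrite indicE memNset ?mulr0// => /KJ.
Qed.

Lemma partial_op_halves (R : realType) (alpha : set R -> R) (f : R -> R)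
    (a b x : R) (X Y : set (set R)) : a < b ->
  nonneg_L1_on `[a, b[%classic f -> carleson_on `[a, b[%classic alpha ->
  X `<=` dyadic `[a, (a + b) / 2[%classic ->
  Y `<=` dyadic `[(a + b) / 2, b[%classic ->
  partial_op alpha f ([set `[a, b[%classic] `|` (X `|` Y)) x =
  ((alpha `[a, b[%classic * avg f `[a, b[%classic * \1_(`[a, b[%classic) x)%:E +
   (partial_op alpha f X x + partial_op alpha f Y x))%E.
Proof.
move=> ab f0 Ca Xl Yr; rewrite /partial_op esum_halves// => K XYK.
apply: (partial_op_term_ge0 _ ab f0 Ca); rewrite dyadic_split//.
by apply: setUS XYK; exact: setUSS.
Qed.

Lemma carleson_mass_halves (R : realType) (alpha : set R -> R)
    (a b : R) (X Y : set (set R)) : a < b ->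
  carleson_on `[a, b[%classic alpha ->
  X `<=` dyadic `[a, (a + b) / 2[%classic ->
  Y `<=` dyadic `[(a + b) / 2, b[%classic ->
  carleson_mass alpha ([set `[a, b[%classic] `|` (X `|` Y)) =
  ((alpha `[a, b[%classic * (b - a)%R)%:E +
   (carleson_mass alpha X + carleson_mass alpha Y))%E.
Proof.
move=> ab [a0 _] Xl Yr; rewrite /carleson_mass esum_halves//.
  by rewrite meas_co.
move=> K XYK; apply: mule_ge0 => //; rewrite lee_fin; apply: a0.
rewrite dyadic_split//.
by apply: setUS XYK; exact: setUSS.
Qed.

Lemma partial_op_measurable (R : realType) (alpha : set R -> R) (f : R -> R)
    n (a b : R) : a < b ->
  nonneg_L1_on `[a, b[%classic f -> carleson_on `[a, b[%classic alpha ->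
  measurable_fun [set: R] (partial_op alpha f (dyadic_upto n a b)).
Proof.
elim: n a b => [|n IH] a b ab f0 Ca.
  rewrite (_ : partial_op _ _ _ = cst 0%E); first exact: measurable_cst.
  by apply/funext => x; exact: esum_set0.
have lm : a < (a + b) / 2 by lra.
have mr : (a + b) / 2 < b by lra.
rewrite (_ : partial_op _ _ _ = fun x =>
    ((alpha `[a, b[%classic * avg f `[a, b[%classic
        * \1_(`[a, b[%classic) x)%:E +
     (partial_op alpha f (dyadic_upto n a ((a + b) / 2)%R) x +
      partial_op alpha f (dyadic_upto n ((a + b) / 2)%R b) x))%E); last first.
  by apply/funext => x; apply: partial_op_halves => //; exact: dyadic_upto_sub.
apply: emeasurable_funD; last apply: emeasurable_funD.
- by apply/measurable_EFinP; exact: measurable_funM.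
- apply: IH => //.
  + exact: nonneg_L1_on_sub (dyadic_left_half _ _) f0.
  + exact: carleson_on_sub (dyadic_left_half _ _) Ca.
- apply: IH => //.
  + exact: nonneg_L1_on_sub (dyadic_right_half _ _) f0.
  + exact: carleson_on_sub (dyadic_right_half _ _) Ca.
Qed.

(** * The upper bound *)

Lemma superlevel_upto_measurable (R : realType) (alpha : set R -> R)
    (f : R -> R) n (a b lam : R) : a < b ->
  nonneg_L1_on `[a, b[%classic f -> carleson_on `[a, b[%classic alpha ->
  measurable [set x | `[a, b[%classic x /\
                      (lam%:E < partial_op alpha f (dyadic_upto n a b) x)%E].
Proof.
move=> ab f0 Ca.
have mS := partial_op_measurable n ab f0 Ca.
apply: (@emeasurable_fun_o_infty _ _ _ `[a, b[%classic _ _ _ lam%:E) => //.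
exact: measurable_funTS.
Qed.

Lemma carleson_mass_upto (R : realType) (alpha : set R -> R) n (a b : R) :
  a < b -> carleson_on `[a, b[%classic alpha ->
  exists M : R, [/\ carleson_mass alpha (dyadic_upto n a b) = M%:E, 0 <= M &
                    M <= b - a].
Proof.
move=> ab [al0 Ca].
have M0 : (0 <= carleson_mass alpha (dyadic_upto n a b))%E.
  apply: esum_ge0 => K /(dyadic_upto_sub ab) JK.
  by apply: mule_ge0; rewrite ?lee_fin ?al0// /meas measure_ge0.
have Mle : (carleson_mass alpha (dyadic_upto n a b) <= (b - a)%:E)%E.
  rewrite -meas_co//; apply: le_trans (Ca _ (dyadic_self _)).
  by apply: esum_subset; exact: dyadic_upto_sub.
have Mfin : carleson_mass alpha (dyadic_upto n a b) \is a fin_num.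
  by rewrite ge0_fin_numE// (le_lt_trans Mle)// ltry.
exists (fine (carleson_mass alpha (dyadic_upto n a b))).
by split; [rewrite fineK|exact: fine_ge0|rewrite -lee_fin fineK].
Qed.

(** The parameter kap stays fixed in the induction: the level changes from an
    interval to its halves, and the weights follow it.  If A s >= lam the
    potential already exceeds 1; otherwise the superlevel set splits into those
    of the halves at the level lam - al s. *)
Lemma truncated_weak_bound (R : realType) (alpha : set R -> R) (f : R -> R)
    (kap : R) n (a b lam : R) : 0 < kap -> a < b ->
  nonneg_L1_on `[a, b[%classic f -> carleson_on `[a, b[%classic alpha ->
  0 < lam -> kap * lam <= 1 ->
  (meas [set x | `[a, b[%classic x /\
                 (lam%:E < partial_op alpha f (dyadic_upto n a b) x)%E] <=
   (mass_weight (kap * lam) *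
      (kap * \int[lebesgue_measure]_(x in `[a, b[) f x))%:E +
   (carleson_weight (kap * lam))%:E *
      carleson_mass alpha (dyadic_upto n a b))%E.
Proof.
move=> kap0; elim: n a b lam => [|n IH] a b lam ab f0 Ca lam0 kl1.
  rewrite (_ : [set _ | _] = set0); last first.
    apply/seteqP; split=> // x /= [_]; rewrite /partial_op esum_set0.
    by rewrite lte_fin ltNge (ltW lam0).
  rewrite /meas measure0 /carleson_mass esum_set0 mule0 adde0 lee_fin.
  apply: mulr_ge0; first exact: le_trans ler01 (mass_weight_ge1 _).
  by apply: mulr_ge0; [exact: ltW|apply: Rintegral_ge0; exact: f0.2].
set m := (a + b) / 2.
have am : a < m by rewrite /m; lra.
have mb : m < b by rewrite /m; lra.
have lJ := dyadic_left_half a b; have rJ := dyadic_right_half a b.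
have f0l := nonneg_L1_on_sub ab lJ f0; have f0r := nonneg_L1_on_sub ab rJ f0.
have Cl := carleson_on_sub lJ Ca; have Cr := carleson_on_sub rJ Ca.
have Ul := dyadic_upto_sub (n := n) am; have Ur := dyadic_upto_sub (n := n) mb.
have [Ml [MlE Ml0 _]] := carleson_mass_upto n am Cl.
have [Mr [MrE Mr0 _]] := carleson_mass_upto n mb Cr.
have [M [ME M0 Mle]] := carleson_mass_upto n.+1 ab Ca.
have MMM : M = alpha `[a, b[%classic * (b - a) + (Ml + Mr).
  by apply: EFin_inj; rewrite -ME /= carleson_mass_halves// MlE MrE.
pose s := avg f `[a, b[%classic; pose al := alpha `[a, b[%classic.
pose A := M / (b - a).
have ba0 : 0 < b - a by rewrite subr_gt0.
have s0 : 0 <= s by apply: avg_ge0; exact: f0.2.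
have al0 : 0 <= al by apply: Ca.1; exact: dyadic_self.
have alA : al <= A.
  by rewrite ler_pdivlMr// MMM lerDl addr_ge0.
have A1 : A <= 1 by rewrite ler_pdivrMr// mul1r.
have AE : M = A * (b - a) by rewrite mulfVK// gt_eqF.
have sE : \int[lebesgue_measure]_(x in `[a, b[) f x = s * (b - a).
  exact: avg_co.
have t0 : 0 < kap * lam by rewrite mulr_gt0.
rewrite ME sE -EFinM -EFinD.
(* Either the mass available in J may already reach the level, or al s leaves
   a positive level to the halves. *)
have [lamAs|Aslam] := leP lam (A * s).
  apply: (@le_trans _ _ (b - a)%:E).
    rewrite -meas_co//; apply: le_measure; rewrite ?inE//.
    - exact: superlevel_upto_measurable.
    - by move=> x [].
  have := @potential_ge1 _ (kap * lam) (kap * s) A.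
  rewrite t0 kl1 A1 (le_trans al0 alA) => /(_ isT isT).
  rewrite mulrCA ler_pM2l// => /(_ lamAs) ge1.
  by rewrite lee_fin AE; nra.
have als : al * s <= A * s by exact: ler_wpM2r.
have lam'0 : 0 < lam - al * s by lra.
have kl'1 : kap * (lam - al * s) <= 1.
  by apply: le_trans kl1; rewrite ler_pM2l// gerBl mulr_ge0.
have IHl := IH _ _ _ am f0l Cl lam'0 kl'1.
have IHr := IH _ _ _ mb f0r Cr lam'0 kl'1.
set Sl := [set x | _ /\ _] in IHl; set Sr := [set x | _ /\ _] in IHr.
have mSl : measurable Sl by exact: superlevel_upto_measurable.
have mSr : measurable Sr by exact: superlevel_upto_measurable.
apply: (@le_trans _ _ (meas Sl + meas Sr)%E).
  apply: le_trans (measureU2 _ _ _) => //.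
  apply: le_measure; rewrite ?inE//.
  - exact: superlevel_upto_measurable.
  - exact: measurableU.
  move=> x [Jx]; rewrite partial_op_halves//.
  rewrite indicE mem_set// mulr1 -lteBlDl// -EFinB => Sx.
  have [xm|mx] := ltP x m.
  - left; split; first by move: Jx; rewrite /= !in_itv/= xm => /andP[->].
    move: Sx; rewrite [X in (_ + X)%E](partial_op_out _ _ mb) ?adde0//.
    by rewrite /= in_itv/= leNgt xm.
  - right; split; first by move: Jx; rewrite /= !in_itv/= mx => /andP[_ ->].
    move: Sx; rewrite [X in (X + _)%E](partial_op_out _ _ am) ?add0e//.
    by rewrite /= in_itv/= ltNge mx andbF.
apply: (le_trans (leeD IHl IHr)).
rewrite MlE MrE -!EFinM -!EFinD lee_fin.
have := @potential_jump _ (kap * lam) (kap * s) A al.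
rewrite al0 alA A1 kl1 mulr_ge0 ?(ltW kap0)// => /(_ isT isT isT).
have -> : kap * lam - al * (kap * s) = kap * (lam - al * s) by ring.
rewrite mulrCA ler_pM2l// mulr_gt0// => /(_ (ltW Aslam) isT isT) jump.
have sums : \int[lebesgue_measure]_(x in `[a, m[) f x +
   \int[lebesgue_measure]_(x in `[m, b[) f x = s * (b - a).
  by rewrite -sE (Rintegral_halves ab f0.1).
have masses : Ml + Mr = (A - al) * (b - a).
  by rewrite mulrBl -AE MMM /al; ring.
have collect (w1 w2 il ir : R) : il + ir = s * (b - a) ->
    w1 * (kap * il) + w2 * Ml + (w1 * (kap * ir) + w2 * Mr) =
    (w1 * (kap * s) + w2 * (A - al)) * (b - a).
  move=> ilr; transitivity (w1 * kap * (il + ir) + w2 * (Ml + Mr)).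
    by ring.
  by rewrite ilr masses; ring.
rewrite (collect _ _ _ _ sums) [X in _ <= X](_ : _ =
  (mass_weight (kap * lam) * (kap * s) + carleson_weight (kap * lam) * A)
    * (b - a)); last by rewrite AE; ring.
by rewrite ler_pM2r.
Qed.

Lemma norm_L1E (R : realType) (f : R -> R) :
  nonneg_L1_on (@unit_itv R) f ->
  norm_L1 f = \int[lebesgue_measure]_(x in @unit_itv R) f x.
Proof.
move=> [_ f0]; apply: eq_Rintegral => x /set_mem Jx.
by rewrite ger0_norm// f0.
Qed.

(** Continuity from below of the measure reduces the full operator to finitely
    many generations. *)
Lemma superlevel_carleson_op (R : realType) (alpha : set R -> R) (f : R -> R)
    (lam : R) :
  nonneg_L1_on (@unit_itv R) f -> carleson_on (@unit_itv R) alpha ->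
  superlevel (carleson_op alpha f) lam =
  \bigcup_n [set x | @unit_itv R x /\
                     (lam%:E < partial_op alpha f (dyadic_upto n 0 1) x)%E].
Proof.
move=> f0 Ca; apply/seteqP; split=> x.
  rewrite /superlevel/= => -[Jx Sx].
  have [|n Sn] := (esum_dyadic_gt lam%:E ltr01 _).1 Sx.
    by move=> K; exact: (partial_op_term_ge0 _ ltr01 f0 Ca).
  by exists n.
move=> [n _ [Jx Sn]]; split=> //; apply: (esum_dyadic_gt lam%:E ltr01 _).2.
  by move=> K; exact: (partial_op_term_ge0 _ ltr01 f0 Ca).
by exists n.
Qed.

Lemma superlevel_measurable (R : realType) (alpha : set R -> R) (f : R -> R)
    (lam : R) :
  nonneg_L1_on (@unit_itv R) f -> carleson_on (@unit_itv R) alpha ->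
  measurable (superlevel (carleson_op alpha f) lam).
Proof.
move=> f0 Ca; rewrite superlevel_carleson_op//; apply: bigcupT_measurable => n.
exact: superlevel_upto_measurable ltr01 f0 Ca.
Qed.

Lemma meas_unit_itv (R : realType) : meas (@unit_itv R) = 1%E.
Proof. by rewrite meas_co// subr0. Qed.

(** For s <= lam the parameter kap = 1 / (lam + s) is in the harmonic regime,
    and the potential at A = 1 is 2 (lam s + s^2) / (lam + s)^2. *)
Lemma weak_type_bound (R : realType) (alpha : set R -> R) (f : R -> R)
    (lam : R) :
  nonneg_L1_on (@unit_itv R) f -> carleson_on (@unit_itv R) alpha -> 0 < lam ->
  (meas (superlevel (carleson_op alpha f) lam) <=
   (weak_bound lam (norm_L1 f))%:E)%E.
Proof.
move=> f0 Ca lam0; have mS := superlevel_measurable lam f0 Ca.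
have s0 : 0 <= norm_L1 f by exact: Rintegral_ge0.
rewrite /weak_bound; case: ifPn => [s_le|_]; last first.
  rewrite -[leRHS]meas_unit_itv; apply: le_measure; rewrite ?inE//.
  - exact: measurable_itv.
  - by move=> x [].
set s := norm_L1 f in s0 s_le *.
have sl0 : 0 < lam + s by lra.
pose kap := (lam + s)^-1.
have kap0 : 0 < kap by rewrite invr_gt0.
have klam1 : kap * lam <= 1 by rewrite ler_pdivrMl// mulr1; lra.
have klam_ge : 2^-1 <= kap * lam by rewrite ler_pdivlMl//; lra.
pose S n := [set x | @unit_itv R x /\
  (lam%:E < partial_op alpha f (dyadic_upto n 0 1) x)%E].
have mSn n : measurable (S n) by exact: superlevel_upto_measurable ltr01 f0 Ca.
have Sn_le n : (meas (S n) <= (2 * s / (lam + s))%:E)%E.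
  apply: le_trans (truncated_weak_bound n kap0 ltr01 f0 Ca lam0 klam1) _.
  have [M [-> M0]] := carleson_mass_upto n ltr01 Ca.
  rewrite subr0 -(norm_L1E f0) -/s -EFinM -EFinD lee_fin => M1.
  rewrite /mass_weight /carleson_weight klam_ge.
  apply: (@le_trans _ _
    (2 * (kap * lam) * (kap * s) + 2 * (1 - kap * lam) ^+ 2)).
    by rewrite lerD2l ler_piMr// mulr_ge0// sqr_ge0.
  by rewrite /kap le_eqVlt; apply/orP; left; apply/eqP; field; lra.
rewrite superlevel_carleson_op//.
have ndS : nondecreasing_seq S.
  move=> n k nk; apply/subsetPset => x [Jx lt_n]; split=> //.
  apply: lt_le_trans lt_n _; apply: esum_subset; exact: dyadic_upto_nd.
have cvgS := nondecreasing_cvg_mu (mu := lebesgue_measure) mSn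
  (bigcupT_measurable _ mSn) ndS.
rewrite /meas -(cvg_lim _ cvgS)//; apply: lime_le.
  by apply/cvg_ex; eexists; exact: cvgS.
by apply: nearW => n; exact: Sn_le.
Qed.

Lemma carleson_op_abs (R : realType) (alpha : set R -> R) (f : R -> R) :
  nonneg_L1_on (@unit_itv R) f -> carleson_on (@unit_itv R) alpha ->
  (fun x => `|carleson_op alpha f x|)%E = carleson_op alpha f.
Proof.
move=> f0 Ca; apply/funext => x; rewrite gee0_abs//; apply: esum_ge0 => K.
exact: (partial_op_term_ge0 _ ltr01 f0 Ca).
Qed.

Lemma weak_norm_le (R : realType) (alpha : set R -> R) (f : R -> R) :
  nonneg_L1_on (@unit_itv R) f -> carleson_on (@unit_itv R) alpha ->
  (weak_norm (carleson_op alpha f) <= (2 * norm_L1 f)%:E)%E.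
Proof.
move=> f0 Ca; apply: ge_ereal_sup => _ [lam /= lam0 <-].
rewrite (carleson_op_abs f0 Ca).
have s0 : 0 <= norm_L1 f by exact: Rintegral_ge0.
apply: (@le_trans _ _ (lam%:E * (weak_bound lam (norm_L1 f))%:E)%E).
  by apply: lee_wpmul2l; rewrite ?lee_fin ?(ltW lam0)//; exact: weak_type_bound.
rewrite -EFinM lee_fin /weak_bound; case: ifPn => [_|]; last first.
  by rewrite -ltNge => ?; lra.
rewrite mulrA ler_pdivrMr; nra.
Qed.

(** * Building extremal examples *)

(** Quantifying over all intervals spares any rescaling when two examples are
    put side by side.  The level may be negative: it is what is left once the
    coefficients of the ancestors have been spent. *)
Definition achievable (R : realType) (s A lam q : R) : Prop :=
  forall a b : R, a < b -> exists (f : R -> R) (alpha : set R -> R),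
  [/\ nonneg_L1_on `[a, b[%classic f,
      \int[lebesgue_measure]_(x in `[a, b[) f x = s * (b - a),
      carleson_on `[a, b[%classic alpha,
      (carleson_mass alpha (dyadic `[a, b[%classic) <= (A * (b - a))%:E)%E &
      exists E : set R, [/\ measurable E, E `<=` `[a, b[%classic,
        forall x, E x ->
          (lam%:E < partial_op alpha f (dyadic `[a, b[%classic) x)%E &
        ((q * (b - a))%:E <= meas E)%E]].

(** With no coefficients the operator vanishes, so that the superlevel set is
    everything when lam < 0; the empty set serves as a witness at any level. *)
Lemma achievable_cst (R : realType) (s lam : R) (full : bool) :
  0 <= s -> full ==> (lam < 0) -> achievable s 0 lam full%:R.
Proof.
move=> s0 lamE a b ab; exists (cst s), (fun=> 0).
have mass0 (X : set (set R)) : carleson_mass (fun=> 0) X = 0%E.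
  by apply: esum1 => K _; rewrite mul0e.
split.
- split; last by move=> x _.
  apply: measurable_bounded_integrable => //=.
  + by rewrite [ltLHS](meas_co ab) ltry.
  + by exists `|s|; split => // M sM x _ /=; exact: ltW.
- by rewrite Rintegral_cst//; congr (_ * _); exact: (congr1 fine (meas_co ab)).
- by split=> // K _; rewrite mass0 measure_ge0.
- by rewrite mass0 mul0r.
case: full lamE => [/= lam0|_].
- exists `[a, b[%classic; split=> //; last by rewrite mul1r meas_co.
  move=> x _; rewrite /partial_op esum1 ?lte_fin// => K _.
  by rewrite !mul0r.
- exists set0; split=> //.
  by rewrite mul0r /meas measure0.
Qed.

Definition glue_fun (R : realType) (m : R) (f g : R -> R) (x : R) : R :=
  if x < m then f x else g x.

Lemma integrable_glue_fun (R : realType) (f g : R -> R) (a m b : R) :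
  lebesgue_measure.-integrable `[a, m[ (EFin \o f) ->
  lebesgue_measure.-integrable `[m, b[ (EFin \o g) ->
  lebesgue_measure.-integrable (`[a, m[%classic `|` `[m, b[%classic)
     (EFin \o glue_fun m f g).
Proof.
move=> intf intg; set h := glue_fun m f g.
have /integrableP[mf fy] : lebesgue_measure.-integrable `[a, m[ (EFin \o h).
  apply: eq_integrable intf => // x; rewrite inE/= in_itv/= => /andP[_ xm].
  by rewrite /h /glue_fun/= xm.
have /integrableP[mg gy] : lebesgue_measure.-integrable `[m, b[ (EFin \o h).
  apply: eq_integrable intg => // x; rewrite inE/= in_itv/= => /andP[mx _].
  by rewrite /h /glue_fun/= ltNge mx.
have mh : measurable_fun (`[a, m[%classic `|` `[m, b[%classic) (EFin \o h).
  exact/measurable_funU.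
apply/integrableP; split=> //; rewrite ge0_integral_setU//.
- exact: lte_add_pinfty.
- exact: measurableT_comp.
- apply/disj_setPS => x [] /=; rewrite !in_itv/=; lra.
Qed.

Definition glue_coeff (R : realType) (J L : set R) (al : R)
    (alpha beta : set R -> R) (K : set R) : R :=
  if K == J then al else if `[< K `<=` L >] then alpha K else beta K.

(** The converse of the upper-bound recursion: all data average over the two
    halves, and the coefficient al raises both the Carleson mass by al and the
    operator by al times the average. *)
Lemma achievable_glue (R : realType) (al s1 A1 q1 s2 A2 q2 lam : R) :
  0 <= al -> al + (A1 + A2) / 2 <= 1 ->
  achievable s1 A1 lam q1 -> achievable s2 A2 lam q2 ->
  achievable ((s1 + s2) / 2) (al + (A1 + A2) / 2)
    (lam + al * ((s1 + s2) / 2)) ((q1 + q2) / 2).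
Proof.
move=> al0 A_le1 ach1 ach2 a b ab.
pose m := (a + b) / 2.
have am : a < m by rewrite /m; lra.
have mb : m < b by rewrite /m; lra.
have [f1 [alpha1 [f1_L1 f1_int C1 M1 [E1 [mE1 E1l E1lam qE1]]]]] := ach1 _ _ am.
have [f2 [alpha2 [f2_L1 f2_int C2 M2 [E2 [mE2 E2r E2lam qE2]]]]] := ach2 _ _ mb.
pose f := glue_fun m f1 f2.
pose alpha := glue_coeff `[a, b[%classic `[a, m[%classic al alpha1 alpha2.
have fl x : `[a, m[%classic x -> f x = f1 x.
  by rewrite /= in_itv/= /f /glue_fun => /andP[_ ->].
have fr x : `[m, b[%classic x -> f x = f2 x.
  by rewrite /= in_itv/= /f /glue_fun => /andP[mx _]; rewrite ltNge mx.
have alphal K : dyadic `[a, m[%classic K -> alpha K = alpha1 K.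
  move=> lK; rewrite /alpha /glue_coeff ifN; last exact/eqP/dyadic_left_neq.
  by rewrite ifT//; apply/asboolP; exact: dyadic_sub lK.
have alphar K : dyadic `[m, b[%classic K -> alpha K = alpha2 K.
  move=> rK; rewrite /alpha /glue_coeff ifN; last exact/eqP/dyadic_right_neq.
  rewrite ifN//; apply/asboolP => Kl.
  have [c [d [mc cd _ KE]]] := dyadic_itv mb rK.
  have : `[a, m[%classic c by apply: Kl; rewrite KE/= in_itv/= lexx.
  by rewrite /= in_itv/=; lra.
have alphaJ : alpha `[a, b[%classic = al by rewrite /alpha /glue_coeff eqxx.
have avgl K : dyadic `[a, m[%classic K -> avg f K = avg f1 K.
  move=> lK; rewrite /avg; congr (_ * _); apply: eq_Rintegral => x /set_mem Kx.
  by apply: fl; exact: dyadic_sub Kx.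
have avgr K : dyadic `[m, b[%classic K -> avg f K = avg f2 K.
  move=> rK; rewrite /avg; congr (_ * _); apply: eq_Rintegral => x /set_mem Kx.
  by apply: fr; exact: dyadic_sub Kx.
have f_L1 : nonneg_L1_on `[a, b[%classic f.
  rewrite co_halves//; split.
    exact: integrable_glue_fun f1_L1.1 f2_L1.1.
  move=> x [lx|rx]; first by rewrite fl//; exact: f1_L1.2.
  by rewrite fr//; exact: f2_L1.2.
have f_int :
    \int[lebesgue_measure]_(x in `[a, b[) f x = (s1 + s2) / 2 * (b - a).
  rewrite (Rintegral_halves ab f_L1.1) -/m.
  have -> : \int[lebesgue_measure]_(x in `[a, m[) f x = s1 * (m - a).
    by rewrite -f1_int; apply: eq_Rintegral => x /set_mem; exact: fl.
  have -> : \int[lebesgue_measure]_(x in `[m, b[) f x = s2 * (b - m).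
    by rewrite -f2_int; apply: eq_Rintegral => x /set_mem; exact: fr.
  by rewrite /m; lra.
have massl K : dyadic `[a, m[%classic K ->
    carleson_mass alpha (dyadic K) = carleson_mass alpha1 (dyadic K).
  move=> lK; apply: eq_esum => L KL; rewrite alphal//; exact: dyadic_trans KL.
have massr K : dyadic `[m, b[%classic K ->
    carleson_mass alpha (dyadic K) = carleson_mass alpha2 (dyadic K).
  move=> rK; apply: eq_esum => L KL; rewrite alphar//; exact: dyadic_trans KL.
have alpha0 K : dyadic `[a, b[%classic K -> 0 <= alpha K.
  rewrite dyadic_split// -/m => -[->|[lK|rK]]; first by rewrite alphaJ.
  - by rewrite alphal//; exact: C1.1.
  - by rewrite alphar//; exact: C2.1.
have massJ : (carleson_mass alpha (dyadic `[a, b[%classic) <=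
    ((al + (A1 + A2) / 2) * (b - a))%:E)%E.
  rewrite /carleson_mass esum_dyadic//; last first.
    by move=> K JK; rewrite mule_ge0 ?lee_fin ?alpha0// /meas measure_ge0.
  rewrite -/m -[X in (_ + (X + _) <= _)%E]/(carleson_mass _ _).
  rewrite -[X in (_ + (_ + X) <= _)%E]/(carleson_mass _ _).
  rewrite massl ?massr; [|exact: dyadic_self..].
  rewrite alphaJ meas_co//.
  apply: le_trans (leeD2l _ (leeD M1 M2)) _.
  by rewrite -EFinM -!EFinD lee_fin /m; lra.
have Ca : carleson_on `[a, b[%classic alpha.
  split=> // K; rewrite dyadic_split// -/m => -[->|[lK|rK]].
  - apply: le_trans massJ _; rewrite meas_co// lee_fin.
    by rewrite ler_piMl//; lra.
  - by rewrite massl//; exact: C1.2.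
  - by rewrite massr//; exact: C2.2.
have avgJ : avg f `[a, b[%classic = (s1 + s2) / 2.
  have ba0 : b - a != 0 by rewrite subr_eq0 gt_eqF.
  by apply: (mulIf ba0); rewrite -avg_co.
exists f, alpha; split=> //.
have opJ x : `[a, b[%classic x ->
  partial_op alpha f (dyadic `[a, b[%classic) x =
  ((al * ((s1 + s2) / 2))%:E +
   (partial_op alpha1 f1 (dyadic `[a, m[%classic) x +
    partial_op alpha2 f2 (dyadic `[m, b[%classic) x))%E.
  move=> Jx; rewrite dyadic_split// partial_op_halves//.
  rewrite indicE mem_set// mulr1 alphaJ avgJ; congr (_ + (_ + _))%E.
  - by apply: eq_esum => K lK; rewrite alphal ?avgl.
  - by apply: eq_esum => K rK; rewrite alphar ?avgr.
exists (E1 `|` E2); split.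
- exact: measurableU.
- by rewrite co_halves//; exact: setUSS.
- move=> x [E1x|E2x].
  + have lx := E1l _ E1x; rewrite opJ; last by rewrite co_halves//; left.
    rewrite [X in (_ + (_ + X))%E](partial_op_out _ _ mb) ?adde0//; last first.
      by move: lx; rewrite /= !in_itv/=; lra.
    by rewrite EFinD addeC lteD2lE// E1lam.
  + have rx := E2r _ E2x; rewrite opJ; last by rewrite co_halves//; right.
    rewrite [X in (_ + (X + _))%E](partial_op_out _ _ am) ?add0e//; last first.
      by move: rx; rewrite /= !in_itv/=; lra.
    by rewrite EFinD addeC lteD2lE// E2lam.
- rewrite /meas measureU//; last first.
    rewrite -subset0 => x [/E1l + /E2r]; rewrite /= !in_itv/=; lra.
  apply: le_trans (leeD qE1 qE2).
  by rewrite -EFinD lee_fin /m; lra.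
Qed.

(** * Sharpness *)

Lemma achievable_cast (R : realType) (s A lam q s' A' lam' q' : R) :
  s = s' -> A = A' -> lam = lam' -> q = q' ->
  achievable s A lam q -> achievable s' A' lam' q'.
Proof. by move=> -> -> -> ->. Qed.

(** A coefficient 1 on the whole interval makes the operator equal to s. *)
Lemma achievable_saturate (R : realType) (s lam : R) :
  0 <= s -> lam < s -> achievable s 1 lam 1.
Proof.
move=> s0 lams.
have half : achievable s 0 (lam - s) 1.
  by apply: (@achievable_cst _ s _ true) => //=; rewrite subr_lt0.
have := achievable_glue ler01 _ half half.
rewrite addr0 mul0r addr0 lexx => /(_ isT).
by apply: achievable_cast => //; lra.
Qed.

(** Keep the example on the dyadic pieces of sizes 1/2, ..., 1/2^k and put
    nothing on the remaining piece of size 1/2^k. *)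
Lemma achievable_dilute (R : realType) (s lam q : R) k :
  achievable s 1 lam q ->
  achievable ((1 - 2^-1 ^+ k) * s) (1 - 2^-1 ^+ k) lam ((1 - 2^-1 ^+ k) * q).
Proof.
move=> ach; elim: k => [|k IH].
  have := @achievable_cst _ 0 lam false (lexx _) isT.
  by apply: achievable_cast; rewrite ?expr0 ?subrr ?mul0r.
have p0 : 0 <= 2^-1 ^+ k :> R by rewrite exprn_ge0.
have := achievable_glue (lexx _) _ ach IH.
have A_le1 : 0 + (1 + (1 - 2^-1 ^+ k)) / 2 <= 1 :> R by lra.
by move=> /(_ A_le1); apply: achievable_cast; rewrite ?exprS; lra.
Qed.

(** Diluting by r frees a Carleson mass 1 - r, which is spent on top.  The top
    glues the example with its k-fold dilution, whence the exponent k + 1. *)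
Lemma achievable_step (R : realType) (s lam q : R) k :
  achievable s 1 lam q ->
  let r := 1 - 2^-1 ^+ k.+1 in
  achievable (r * s) 1 (lam + (1 - r) * (r * s)) (r * q).
Proof.
move=> ach r; have p0 : 0 <= 2^-1 ^+ k :> R by rewrite exprn_ge0.
have rE : r = 1 - 2^-1 * 2^-1 ^+ k by rewrite /r exprS.
have := @achievable_glue _ (1 - r) _ _ _ _ _ _ _ _ _ ach
  (achievable_dilute k ach).
have d0 : 0 <= 1 - r by lra.
have A_le1 : 1 - r + (1 + (1 - 2^-1 ^+ k)) / 2 <= 1 by lra.
by move=> /(_ d0 A_le1); apply: achievable_cast; rewrite ?rE; lra.
Qed.

(** The levels gained are (1 - r) r^i s for i = 1, ..., n, a geometric sum. *)
Lemma achievable_iter (R : realType) (s lam q : R) k n :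
  achievable s 1 lam q ->
  let r := 1 - 2^-1 ^+ k.+1 in
  achievable (r ^+ n * s) 1 (lam + r * (1 - r ^+ n) * s) (r ^+ n * q).
Proof.
move=> ach r; elim: n => [|n IH].
  by move: ach; apply: achievable_cast; rewrite ?expr0 ?subrr; lra.
by move: (achievable_step k IH); apply: achievable_cast;
  rewrite -/r ?exprS; ring.
Qed.

Lemma expr_small (R : realType) (x e : R) :
  0 <= x < 1 -> 0 < e -> exists n, x ^+ n < e.
Proof.
move=> /andP[x0 x1] e0.
have /cvgr_lt/(_ _ e0)[n _ /(_ n (leqnn n)) xn] : x ^+ n @[n --> \oo] --> 0.
  by apply: cvg_expr; rewrite ger0_norm.
by exists n.
Qed.

(** With q = r^n, the survivors need an average s / q above the remaining level,
    that is q < th = (1 + r) s / (lam + r s).  The largest such power of r is at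
    least r th, and r th >= 2 s / (lam + s) - 3 (1 - r). *)
Lemma achievable_near_bound (R : realType) (s lam q0 : R) :
  0 < s -> s <= lam -> q0 < 2 * s / (lam + s) ->
  exists2 q : R, q0 <= q & achievable s 1 lam q.
Proof.
move=> s0 s_le q0_lt; set e := 2 * s / (lam + s) - q0.
have [k k_small] : exists k, (2^-1 : R) ^+ k < e / 3.
  by apply: expr_small; rewrite /e; lra.
have d0 : 0 < (2^-1 : R) ^+ k by rewrite exprn_gt0.
pose r : R := 1 - 2^-1 ^+ k.+1.
have d1 : (2^-1 : R) ^+ k <= 1 by rewrite exprn_ile1//; lra.
have rd : 1 - r <= 2^-1 ^+ k by rewrite /r exprS; lra.
have r01 : 0 < r < 1 by rewrite /r exprS; lra.
have [r0 r1] := andP r01.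
have den0 : 0 < lam + r * s by rewrite addr_gt0 ?mulr_gt0//; lra.
pose th := (1 + r) * s / (lam + r * s).
have th0 : 0 < th by rewrite divr_gt0// mulr_gt0//; lra.
have th1 : th <= 1 by rewrite ler_pdivrMr//; lra.
have ex_n : exists n, r ^+ n < th by apply: expr_small; rewrite ?(ltW r0).
have [[|n] n_lt n_min] := ex_minnP ex_n.
  by move: n_lt; rewrite expr0; lra.
have th_le : th <= r ^+ n.
  by rewrite leNgt; apply/negP => /n_min; rewrite ltnn.
pose q := r ^+ n.+1.
have q_gt0 : 0 < q by rewrite exprn_gt0.
exists q.
  have sl0 : 0 < lam + s by lra.
  have th_ge : (1 + r) * (s / (lam + s)) <= th.
    rewrite /th -mulrA ler_pM2l; last lra.
    by rewrite ler_pM2l// lef_pV2 ?posrE//; nra.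
  have rho1 : s / (lam + s) <= 1 by rewrite ler_pdivrMr//; lra.
  have rho0 : 0 <= s / (lam + s) by rewrite divr_ge0//; lra.
  have : r * th <= q by rewrite /q exprS ler_pM2l.
  have eE : e = 2 * (s / (lam + s)) - q0 by rewrite /e mulrA.
  set rho := s / (lam + s) in th_ge rho1 rho0 eE.
  have : r * ((1 + r) * rho) <= r * th by rewrite ler_pM2l.
  have : 2 * rho - e <= r * ((1 + r) * rho).
    have : 3 * (1 - r) <= e by lra.
    nra.
  by lra.
have small : lam - r * (1 - q) * (s / q) < s / q.
  rewrite ltrBlDr -[X in X + _]mul1r -mulrDl mulrA ltr_pdivlMr//.
  move: n_lt; rewrite -/q /th ltr_pdivlMr//; lra.
have sq0 : 0 <= s / q by rewrite divr_ge0// ltW.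
move: (achievable_iter k n.+1 (achievable_saturate sq0 small)).
rewrite -/r -/q; apply: achievable_cast => //.
- by rewrite mulrCA mulfV ?mulr1// gt_eqF.
- by rewrite subrK.
- by rewrite mulr1.
Qed.

Lemma weak_bound_achievable (R : realType) (s lam q0 : R) :
  0 < lam -> 0 <= s -> q0 < weak_bound lam s ->
  exists A q : R, q0 <= q /\ achievable s A lam q.
Proof.
move=> lam0; rewrite le_eqVlt => /predU1P[<-|s0]; rewrite /weak_bound.
  rewrite ltW// mulr0 mul0r => q0_lt; exists 0, 0; split; first exact: ltW.
  exact: (@achievable_cst _ 0 lam false).
have [s_le q0_lt|s_gt q0_lt] := leP s lam.
  have [q q0q ach] := achievable_near_bound s0 s_le q0_lt.
  by exists 1, q.
exists 1, 1; split; first exact: ltW.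
by apply: achievable_saturate => //; exact: ltW.
Qed.

Theorem corollary1p2 (R : realType) :
  (forall (f : R -> R) (alpha : set R -> R) (lambda : R),
      nonneg_L1 f -> carleson_seq alpha -> 0 < lambda ->
      (meas (superlevel (carleson_op alpha f) lambda)
       <= (weak_bound lambda (norm_L1 f))%:E)%E) /\
  (forall lambda s : R, 0 < lambda -> 0 <= s ->
      ereal_sup
        [set y | exists (f : R -> R) (alpha : set R -> R),
            [/\ nonneg_L1 f, norm_L1 f = s, carleson_seq alpha
              & y = meas (superlevel (carleson_op alpha f) lambda)]]
      = (weak_bound lambda s)%:E) /\
  (forall (f : R -> R) (alpha : set R -> R),
      nonneg_L1 f -> carleson_seq alpha ->
      (weak_norm (carleson_op alpha f) <= (2 * norm_L1 f)%:E)%E) /\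
  (forall C : R,
      (forall (f : R -> R) (alpha : set R -> R),
          nonneg_L1 f -> carleson_seq alpha ->
          (weak_norm (carleson_op alpha f) <= (C * norm_L1 f)%:E)%E) ->
      2 <= C).
Proof.
have upper (f : R -> R) (alpha : set R -> R) (lambda : R) : nonneg_L1 f ->
    carleson_seq alpha -> 0 < lambda ->
    (meas (superlevel (carleson_op alpha f) lambda)
     <= (weak_bound lambda (norm_L1 f))%:E)%E.
  by move=> f0 /carleson_seqE Ca; exact: weak_type_bound.
have sharp (lambda s : R) : 0 < lambda -> 0 <= s ->
    ereal_sup
      [set y | exists (f : R -> R) (alpha : set R -> R),
          [/\ nonneg_L1 f, norm_L1 f = s, carleson_seq alpha
            & y = meas (superlevel (carleson_op alpha f) lambda)]]
    = (weak_bound lambda s)%:E.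
  move=> lam0 s0; apply/eqP; rewrite eq_le; apply/andP; split.
    by apply: ge_ereal_sup => _ [f [alpha [f0 <- Ca ->]]]; exact: upper.
  apply/lee_addgt0Pr => e e0.
  have [|A [q [q_ge ach]]] := @weak_bound_achievable _ s lambda
    (weak_bound lambda s - e) lam0 s0; first by rewrite ltrBlDr ltrDl.
  have [f [alpha [f0 f_int Ca _ [E [mE EJ Elam qE]]]]] := ach 0 1 ltr01.
  rewrite -leeBlDr// -EFinB; apply: ereal_sup_ge.
  exists (meas (superlevel (carleson_op alpha f) lambda)).
    exists f, alpha; split=> //; last exact/carleson_seqE.
    by rewrite norm_L1E// [LHS]f_int subr0 mulr1.
  apply: (@le_trans _ _ (meas E)).
    by apply: le_trans qE; rewrite subr0 mulr1 lee_fin.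
  apply: le_measure; rewrite ?inE//; first exact: superlevel_measurable.
  by move=> x Ex; split; [exact: EJ|exact: Elam].
split=> //; split=> //; split=> [f alpha f0 /carleson_seqE Ca|C CP].
  exact: weak_norm_le.
(* lambda times the sharp bound at s = 1 is 2 lambda / (lambda + 1). *)
have lamC lambda : 1 <= lambda -> 2 * lambda <= C * (lambda + 1).
  move=> lam1; have lam0 : 0 < lambda by lra.
  have : ((weak_bound lambda 1)%:E <= (C / lambda)%:E)%E.
    rewrite -sharp//; apply: ge_ereal_sup => _ [f [alpha [f0 f1 Ca ->]]].
    rewrite mulrC EFinM lee_pdivlMl//.
    have := CP f alpha f0 Ca; rewrite f1 mulr1; apply: le_trans.
    apply: ereal_sup_ubound; exists lambda => //.
    by rewrite carleson_op_abs//; exact/carleson_seqE.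
  rewrite lee_fin /weak_bound lam1 ler_pdivlMr// mulr1 mulrAC.
  by rewrite ler_pdivrMr//; lra.
have C1 : 1 <= C by have := lamC 1 (lexx _); lra.
rewrite leNgt; apply/negP => C2.
(* At this level the inequality of lamC becomes (2 - C)^2 <= 0. *)
pose lambda := 2 / (2 - C).
have lamE : lambda * (2 - C) = 2 by rewrite /lambda mulfVK// subr_eq0 gt_eqF.
have lam1 : 1 <= lambda by rewrite ler_pdivlMr//; lra.
have := lamC _ lam1; lra.
Qed.
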